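(* Let $q$ be an even prime power, let $\zeta\in\mathbb{F}_{q^2}^*$, and let $\beta\in\mathbb{F}_{q^2}\setminus\mathbb{F}_q$ be such that $\alpha:=\beta^2+\beta$ is in $\mathbb{F}_q$. Let $n$ be a positive integer. For every $k\in\mathbb{Z}$ we have \[ C_n(\tan_{\zeta,\beta}(k),\alpha)=\tan_{\zeta,\beta}(nk). \]
   Context: With $q$ even and $\zeta,\beta,\alpha$ as in the claim, write $\bar\beta:=\beta^q$, which equals $\beta+1$. For any integer $k$ define \[ \sin_\zeta(k):=\zeta^k+\zeta^{-k},\qquad \cos_{\zeta,\beta}(k):=\beta\zeta^k+\bar\beta\zeta^{-k},\qquad \tan_{\zeta,\beta}(k):=\frac{\sin_\zeta(k)}{\cos_{\zeta,\beta}(k)}. \] The quantities $\sin_\zeta(k)$ and $\cos_{\zeta,\beta}(k)$ are never both zero, so $\tan_{\zeta,\beta}(k)$ is an element of $\mathbb{P}^1(\mathbb{F}_{q^2})=\mathbb{F}_{q^2}\cup\{\infty\}$, equal to $\infty$ when $\cos_{\zeta,\beta}(k)=0$. Set $\rho(x):=(x-\bar\beta)/(x-\beta)$ and $\rho^{-1}(x):=(\beta x-\bar\beta)/(x-1)$, which are inverse under composition. The degree-$n$ Rédei function is $R_n(x,\alpha):=\rho^{-1}\circ x^n\circ\rho\in\mathbb{F}_q(x)$, and the degree-$n$ tangent-Chebyshev rational function (for even $q$) is $C_n(x,\alpha):=\frac1x\circ R_n(x,\alpha)\circ\frac1x=1/R_n(1/x,\alpha)\in\mathbb{F}_q(x)$.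 It is evaluated as a self-map of $\mathbb{P}^1(\mathbb{F}_{q^2})$. *)

(* Defs.v *)
From HB Require Import structures.
From mathcomp Require Import all_boot all_order all_algebra all_field.

Set Implicit Arguments.
Unset Strict Implicit.
Unset Printing Implicit Defensive.

Import GRing.Theory.
Local Open Scope ring_scope.
Local Open Scope quotient_scope.

Notation "x %:F" := (@FracField.tofrac _ x) : ring_scope.

Section RationalFunctions.

Variable K : fieldType.
Implicit Types (f g : {fraction {poly K}}) (p d : {poly K}).

(* [repr f] is an arbitrary fraction representing f; dividing by the gcd puts
   it in lowest terms, so numerator and denominator have no common root. *)
Definition rfnum f : {poly K} :=
  let r := repr f in \n_r %/ gcdp \n_r \d_r.
Definition rfden f : {poly K} :=
  let r := repr f in \d_r %/ gcdp \n_r \d_r.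

Definition rfX : {fraction {poly K}} := 'X%:F.
Definition rfC (c : K) : {fraction {poly K}} := c%:P%:F.

(* The value of p at the rational function g, an element of K(x). *)
Definition poly_at p g : {fraction {poly K}} := (map_poly rfC p).[g].

(* Composition f o g in K(x), for a nonconstant g (which makes the
   denominator nonzero). *)
Definition rfcomp f g : {fraction {poly K}} :=
  poly_at (rfnum f) g / poly_at (rfden f) g.

(* P^1(K) = K with a point at infinity, which is None. *)
Definition P1 : Type := option K.

(* The point [a : b]; only meaningful when a and b are not both 0. *)
Definition P1frac (a b : K) : P1 := if b == 0 then None else Some (a / b).

(* For f = p / d in lowest terms, the value at infinity is the quotient of the
   coefficients of degree max(deg p, deg d). *)
Definition rfeval f (x : P1) : P1 :=
  match x with
  | Some a => P1frac (rfnum f).[a] (rfden f).[a]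
  | None => let m := (maxn (size (rfnum f)) (size (rfden f))).-1 in
            P1frac (rfnum f)`_m (rfden f)`_m
  end.

End RationalFunctions.

Arguments rfX {K}.

Section TangentChebyshev.

Variables (K : fieldType) (q : nat) (beta : K).

Definition betabar : K := beta ^+ q.

Definition rho : {fraction {poly K}} :=
  (rfX - rfC betabar) / (rfX - rfC beta).

Definition rho_inv : {fraction {poly K}} :=
  (rfC beta * rfX - rfC betabar) / (rfX - 1).

(* Redei function R_n(x, alpha), where alpha = beta ^+ 2 + beta; in
   characteristic 2 the other root of x ^+ 2 + x = alpha is betabar, and
   exchanging beta and betabar turns rho into 1 / rho, which leaves R_n
   unchanged, so R_n does depend on alpha only. *)
Definition redei (n : nat) : {fraction {poly K}} :=
  rfcomp rho_inv (rfcomp (rfX ^+ n) rho).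

(* C_n(x, alpha) = 1/x o R_n(x, alpha) o 1/x, for even q. It has coefficients
   in F_q and is viewed here in F_(q^2)(x), to act on P^1(F_(q^2)). *)
Definition tcheb (n : nat) : {fraction {poly K}} :=
  rfcomp rfX^-1 (rfcomp (redei n) rfX^-1).

Definition zsin (zeta : K) (k : int) : K := zeta ^ k + zeta ^ (- k).

Definition zcos (zeta : K) (k : int) : K :=
  beta * zeta ^ k + betabar * zeta ^ (- k).

Definition ztan (zeta : K) (k : int) : P1 K :=
  P1frac (zsin zeta k) (zcos zeta k).

End TangentChebyshev.

(* Main.v *)
(* Up to the substitution x -> 1/x, C_n is x^n conjugated by the Moebius map
   rho, so that C_n = (A - B) / (beta A - betabar B) with
   A = (1 - betabar x)^n and B = (1 - beta x)^n.  Numerator and denominator are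
   invertible combinations of the coprime polynomials A and B, hence this
   fraction is in lowest terms and can be evaluated homogeneously.  As
   betabar = beta + 1 in characteristic 2, at the point [sin k : cos k] the
   linear forms cos - betabar sin and cos - beta sin are zeta^k and zeta^-k, so
   A and B become zeta^(nk) and zeta^(-nk). *)
Require Import Defs.
From HB Require Import structures.
From mathcomp Require Import all_boot all_order all_algebra all_field.
From mathcomp Require Import ring.

Set Implicit Arguments.
Unset Strict Implicit.
Unset Printing Implicit Defensive.

Import GRing.Theory.
Local Open Scope ring_scope.
Local Open Scope quotient_scope.

(** * Rational functions: lowest terms, composition and evaluation *)

Lemma mul_denom_repr (R : idomainType) (f : {fraction R}) :
  f * (\d_(repr f))%:F = (\n_(repr f))%:F.
Proof.
rewrite -{1}[f]reprK; move: (repr f) => r; unlock FracField.tofrac.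
rewrite -[LHS]FracField.pi_mul; apply/eqmodP => /=.
rewrite FracField.equivfE /FracField.mulf.
rewrite !numden_Ratio ?mulf_neq0 ?oner_neq0 ?denom_ratioP //.
by rewrite !mulr1 mulrC.
Qed.

Section RationalFunctionEvaluation.

Variable K : fieldType.
Implicit Types (f g : {fraction {poly K}}) (p d : {poly K}).

HB.instance Definition _ := GRing.RMorphism.copy (@rfC K)
  ((@FracField.tofrac {poly K}) \o polyC).

Lemma poly_atB p d g : poly_at (p - d) g = poly_at p g - poly_at d g.
Proof. by rewrite /poly_at rmorphB hornerD hornerN. Qed.

Lemma poly_atM p d g : poly_at (p * d) g = poly_at p g * poly_at d g.
Proof. by rewrite /poly_at rmorphM hornerM. Qed.

Lemma poly_atXn p m g : poly_at (p ^+ m) g = poly_at p g ^+ m.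
Proof. by rewrite /poly_at rmorphXn horner_exp. Qed.

Lemma poly_atX g : poly_at 'X g = g.
Proof. by rewrite /poly_at map_polyX hornerX. Qed.

Lemma poly_atC c g : poly_at c%:P g = rfC c.
Proof. by rewrite /poly_at map_polyC hornerC. Qed.

Lemma poly_at1 g : poly_at 1 g = 1.
Proof. by rewrite poly_atC rmorph1. Qed.

Definition poly_atE := (poly_atB, poly_atM, poly_atXn, poly_atX,
  poly_at1, poly_atC).

Lemma gcdp_repr_neq0 f : gcdp \n_(repr f) \d_(repr f) != 0.
Proof. by rewrite gcdp_eq0 negb_and denom_ratioP orbT. Qed.

Lemma rfden_neq0 f : rfden f != 0.
Proof.
rewrite /rfden divp_eq0 negb_or denom_ratioP /= negb_or gcdp_repr_neq0.
by rewrite -leqNgt dvdp_leq ?dvdp_gcdr ?denom_ratioP.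
Qed.

Lemma coprimep_rfnum_rfden f : coprimep (rfnum f) (rfden f).
Proof. by rewrite coprimep_div_gcd // denom_ratioP orbT. Qed.

(** Cross-multiply the representative of [f] with [p / d], then cancel the gcd. *)
Lemma rfnum_rfden f p d : d != 0 -> f = p%:F / d%:F ->
  rfnum f * d = p * rfden f.
Proof.
move=> d0 ef; have := mul_denom_repr f.
rewrite {1}ef mulrAC => /(canRL (mulfVK _)); rewrite tofrac_eq0 => /(_ d0).
rewrite -!tofracM => /eqP; rewrite tofrac_eq => /eqP e.
apply: (mulIf (gcdp_repr_neq0 f)).
by rewrite mulrAC -[RHS]mulrA !divpK ?dvdp_gcdl ?dvdp_gcdr.
Qed.

Lemma rfden_dvdp f p d : d != 0 -> f = p%:F / d%:F -> rfden f %| d.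
Proof.
move=> d0 ef; rewrite -(Gauss_dvdpr _ (_ : coprimep (rfden f) (rfnum f))).
  by rewrite (rfnum_rfden d0 ef) dvdp_mull.
by rewrite coprimep_sym coprimep_rfnum_rfden.
Qed.

(** Frees composition from the chosen representative: the reduced denominator divides [d], so it
    does not vanish at [g] either. *)
Lemma rfcompE f p d g : f = p%:F / d%:F -> poly_at d g != 0 ->
  rfcomp f g = poly_at p g / poly_at d g.
Proof.
move=> ef dg0.
have d0 : d != 0 by apply: contraNneq dg0 => ->; rewrite poly_atC rmorph0.
have e := rfnum_rfden d0 ef.
have /dvdpP[c dE] := rfden_dvdp d0 ef.
have den0 : poly_at (rfden f) g != 0.
  by move: dg0; rewrite dE poly_atM mulf_eq0 negb_or => /andP[].
rewrite /rfcomp; apply: (canRL (mulfK dg0)); rewrite mulrAC.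
by apply: (canLR (mulfK den0)); rewrite -(poly_atM (rfnum f)) -(poly_atM p) e.
Qed.

(** By Gauss the two denominators divide each other, so they differ by a nonzero scalar, and
    cross-multiplication carries it to the numerators. *)
Lemma rfnum_rfden_lowest_terms f p d : coprimep p d -> d != 0 -> f = p%:F / d%:F ->
  exists2 c, c != 0 & rfnum f = c *: p /\ rfden f = c *: d.
Proof.
move=> cpd d0 ef; have e := rfnum_rfden d0 ef.
have d2 : d %| rfden f.
  rewrite -(Gauss_dvdpr _ (_ : coprimep d p)) ?[coprimep d p]coprimep_sym //.
  by rewrite -e dvdp_mull.
have /eqpfP : rfden f %= d by rewrite /eqp d2 (rfden_dvdp d0 ef).
set c := _ / _ => dE.
have c0 : c != 0.
  by apply: contraNneq (rfden_neq0 f) => c0; rewrite dE c0 scale0r.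
exists c => //; split=> //; apply: (mulIf d0).
by rewrite e dE -scalerAl scalerAr.
Qed.

Lemma P1frac_scale (c a b : K) : c != 0 -> P1frac (c * a) (c * b) = P1frac a b.
Proof.
move=> c0; rewrite /P1frac mulf_eq0 (negPf c0) /=; case: eqP => // _.
by rewrite -mulf_div divff // mul1r.
Qed.

Lemma rfeval_frac p d x : coprimep p d -> d != 0 ->
  rfeval (p%:F / d%:F) x =
    if x is Some a then P1frac p.[a] d.[a]
    else let m := (maxn (size p) (size d)).-1 in P1frac p`_m d`_m.
Proof.
rewrite /rfeval => cpd d0.
have [c c0 [-> ->]] := rfnum_rfden_lowest_terms cpd d0 erefl.
by case: x => [a|] /=; rewrite ?hornerZ ?size_scale // ?coefZ P1frac_scale.
Qed.

(** Since [1/X - u = (1 - u X) / X], both terms acquire the same power of [X], which later cancels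
    between numerator and denominator. *)
Lemma poly_at_invX (m : nat) (u v a b : K) :
  poly_at (a%:P * ('X - u%:P) ^+ m - b%:P * ('X - v%:P) ^+ m) rfX^-1 =
  (a%:P * (1 - u%:P * 'X) ^+ m - b%:P * (1 - v%:P * 'X) ^+ m)%:F / rfX ^+ m.
Proof.
have X0 : rfX != 0 :> {fraction {poly K}} by rewrite tofrac_eq0 polyX_eq0.
have fac (w : K) : rfX^-1 - rfC w = (1 - w%:P * 'X)%:F / rfX.
  by rewrite rmorphB rmorphM rmorph1 mulrBl mul1r mulfK.
rewrite !poly_atE !fac !expr_div_n !mulrA -mulrBl.
by rewrite [X in _ = X / _]tofracB !tofracM !tofracXn.
Qed.

End RationalFunctionEvaluation.

(** * Field identities and coefficients of powers of linear polynomials *)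

Lemma ratio_sub1_neq0 (F : fieldType) (x y : F) :
  y != 0 -> x - y != 0 -> x / y - 1 != 0.
Proof.
move=> y0; apply: contra; rewrite !subr_eq0 => /eqP e.
by rewrite -(divfK y0 x) e mul1r.
Qed.

Lemma ratio_neq0 (F : fieldType) (x y : F) : x != 0 -> y != 0 -> x / y != 0.
Proof. by move=> x0 y0; rewrite mulf_neq0 ?invr_eq0. Qed.

Lemma ratio_div (F : fieldType) (x y z : F) :
  z != 0 -> (x / z) / (y / z) = x / y.
Proof. by move=> z0; rewrite invf_div mulrA divfK. Qed.

Lemma mobius_ratio (F : fieldType) (a b x y : F) : y != 0 -> x - y != 0 ->
  (a * (x / y) - b) / (x / y - 1) = (a * x - b * y) / (x - y).
Proof. by move=> y0 xy0; field; rewrite y0 xy0. Qed.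

Lemma coef_linear_exp (R : comNzRingType) (n : nat) (c : R) :
  ((1 - c%:P * 'X) ^+ n)`_n = (- c) ^+ n.
Proof.
rewrite addrC -mulNr -polyCN exprDn coef_sum (bigD1 ord0) //= big1.
  rewrite subn0 expr1n mulr1 exprMn -polyC_exp bin0 mulr1n coefCM coefXn.
  by rewrite eqxx mulr1 addr0.
move=> i i0; rewrite coefMn expr1n mulr1 exprMn -polyC_exp coefCM coefXn.
have i_gt0 : (0 < i)%N by rewrite lt0n.
rewrite gtn_eqF ?mulr0 ?mul0rn // ltn_subrL i_gt0.
exact: leq_trans i_gt0 (leq_ord i).
Qed.

Lemma size_linear_exp (R : comNzRingType) (n : nat) (a c : R) :
  (size (a%:P * (1 - c%:P * 'X) ^+ n)%R <= n.+1)%N.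
Proof.
apply/leq_sizeP => j nj; rewrite coefCM addrC -mulNr -polyCN.
rewrite exprDn coef_sum big1 ?mulr0 //.
move=> i _; rewrite coefMn expr1n mulr1 exprMn -polyC_exp coefCM coefXn.
by rewrite gtn_eqF ?mulr0 ?mul0rn // (leq_ltn_trans _ nj) ?leq_subr.
Qed.

(** * Closed form of the tangent-Chebyshev function and its values *)

Section TangentChebyshevFormula.

Variables (K : fieldType) (q : nat) (b : K) (n : nat).
Hypotheses (n_gt0 : (0 < n)%N) (b0 : b != 0) (bq : b ^+ q != b).

Let b' := b ^+ q.

Lemma redeiE : redei q b n =
  (b%:P * ('X - b'%:P) ^+ n - b'%:P * ('X - b%:P) ^+ n)%:F
  / (1%:P * ('X - b'%:P) ^+ n - 1%:P * ('X - b%:P) ^+ n)%:F.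
Proof.
set A := ('X - b'%:P) ^+ n; set B := ('X - b%:P) ^+ n.
have B0 : B%:F != 0 by rewrite tofrac_eq0 expf_eq0 polyXsubC_eq0 andbF.
have AB : A%:F - B%:F != 0.
  (* At [b] the power [B] vanishes, whereas [A] takes the value [(b - b')^n]. *)
  rewrite subr_eq0 tofrac_eq; apply: contraNneq bq => /(congr1 (horner^~ b)).
  rewrite !horner_exp !hornerXsubC subrr [in RHS]expr0n gtn_eqF //.
  by move/eqP; rewrite expf_eq0 subr_eq0 eq_sym => /andP[].
have -> : redei q b n = rfcomp (rho_inv q b) (A%:F / B%:F).
  congr rfcomp; rewrite (@rfcompE _ _ 'X^n 1) ?poly_at1 ?oner_neq0 //.
    rewrite divr1 !poly_atE /rho expr_div_n.
    by rewrite /A /B !tofracXn !tofracB.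
  by rewrite tofrac1 divr1 tofracXn.
rewrite (@rfcompE _ _ (b%:P * 'X - b'%:P) ('X - 1)).
- rewrite !poly_atE !mul1r tofracB !tofracM tofracB.
  exact: (mobius_ratio (rfC b) (rfC b') B0 AB).
- by rewrite /rho_inv !tofracB tofracM tofrac1.
- rewrite poly_atB poly_atX poly_at1; exact: ratio_sub1_neq0 B0 AB.
Qed.

(* The factors [1%:P] give this the shape of [tcheb_den], to which
   [poly_at_invX] and [size_linear_exp] apply. *)
Definition tcheb_num : {poly K} :=
  1%:P * (1 - b'%:P * 'X) ^+ n - 1%:P * (1 - b%:P * 'X) ^+ n.

Definition tcheb_den : {poly K} :=
  b%:P * (1 - b'%:P * 'X) ^+ n - b'%:P * (1 - b%:P * 'X) ^+ n.

(** The point [1/b] kills [1 - b X] but not [1 - b' X]; evaluating there shows that [tcheb_num] and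
    [tcheb_den] are nonzero. *)
Let linB_root : 1 - b * b^-1 = 0.
Proof. by rewrite divff ?subrr. Qed.

Let linA_nroot : (1 - b' * b^-1) ^+ n != 0.
Proof.
rewrite expf_eq0 n_gt0 /= subr_eq0; apply: contra bq => /eqP e.
by rewrite -/b' -[b'](divfK b0) -e mul1r.
Qed.

Lemma tcheb_num_neq0 : tcheb_num != 0.
Proof.
apply: contraNneq linA_nroot => /(congr1 (horner^~ b^-1)).
by rewrite !hornerE linB_root expr0n gtn_eqF // subr0 => ->.
Qed.

Lemma tcheb_den_neq0 : tcheb_den != 0.
Proof.
apply: contraNneq linA_nroot => /(congr1 (horner^~ b^-1)).
rewrite !hornerE linB_root expr0n gtn_eqF // mulr0 subr0.
by move/eqP; rewrite mulf_eq0 (negPf b0).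
Qed.

Lemma tchebE : tcheb q b n = tcheb_num%:F / tcheb_den%:F.
Proof.
have X0 : rfX ^+ n != 0 :> {fraction {poly K}}.
  by rewrite expf_neq0 // tofrac_eq0 polyX_eq0.
have num0 : tcheb_num%:F != 0 by rewrite tofrac_eq0 tcheb_num_neq0.
have den0 : tcheb_den%:F != 0 by rewrite tofrac_eq0 tcheb_den_neq0.
have RE : rfcomp (redei q b n) rfX^-1 = tcheb_den%:F / tcheb_num%:F.
  have numE := poly_at_invX n b' b 1 1.
  have denE := poly_at_invX n b' b b b'.
  rewrite (rfcompE redeiE) numE -/tcheb_num; last exact: ratio_neq0 num0 X0.
  rewrite denE -/tcheb_den; exact: ratio_div X0.
have invXE : rfX^-1 = 1%:F / 'X%:F :> {fraction {poly K}}.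
  by rewrite tofrac1 div1r.
rewrite /tcheb RE (rfcompE invXE) poly_atX; last exact: ratio_neq0 den0 num0.
by rewrite poly_at1 div1r invf_div.
Qed.

Lemma coprimep_tcheb : coprimep tcheb_num tcheb_den.
Proof.
set A := (1 - b'%:P * 'X) ^+ n; set B := (1 - b%:P * 'X) ^+ n.
have bb0 : b - b' != 0 by rewrite subr_eq0 eq_sym.
have c1 : (b - b')^-1%:P * (b%:P - b'%:P) = 1 by rewrite -polyCB -polyCM mulVf.
have /Bezout_eq1_coprimepP[[u v] /= uv] : coprimep A B.
  apply/coprimep_expl/coprimep_expr/Bezout_eq1_coprimepP.
  (* From [b (1 - b' X) - b' (1 - b X) = b - b']. *)
  exists ((b - b')^-1%:P * b%:P, - ((b - b')^-1%:P * b'%:P)) => /=.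
  by rewrite -[RHS]c1; ring.
apply/Bezout_eq1_coprimepP.
(* Substitute [(b - b') A = den - b' num] and [(b - b') B = den - b num] into [u A + v B = 1]. *)
exists ((b - b')^-1%:P * (- b'%:P * u - b%:P * v),
        (b - b')^-1%:P * (u + v)) => /=.
rewrite /tcheb_num /tcheb_den -/A -/B -{}uv.
transitivity ((b - b')^-1%:P * (b%:P - b'%:P) * (u * A + v * B)).
  by ring.
by rewrite c1 mul1r.
Qed.

Lemma coef_tcheb_num : tcheb_num`_n = (- b') ^+ n - (- b) ^+ n.
Proof. by rewrite coefB !mul1r !coef_linear_exp. Qed.

Lemma coef_tcheb_den : tcheb_den`_n = b * (- b') ^+ n - b' * (- b) ^+ n.
Proof. by rewrite coefB !coefCM !coef_linear_exp. Qed.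

(** Identifies the coefficients read off at infinity. Either one of degree [n] may vanish, but not
    both: the combination [den - b' num] has the nonzero coefficient [(b - b') (- b')^n]. *)
Lemma max_size_tcheb : (maxn (size tcheb_num) (size tcheb_den)).-1 = n.
Proof.
have szB (p d : {poly K}) :
  (size p <= n.+1 -> size d <= n.+1 -> size (p - d)%R <= n.+1)%N.
  move=> hp hd; rewrite (leq_trans (size_polyD _ _)) //.
  by rewrite size_polyN geq_max hp.
have sn : (size tcheb_num <= n.+1)%N by apply: szB; apply: size_linear_exp.
have sd : (size tcheb_den <= n.+1)%N by apply: szB; apply: size_linear_exp.
suff /eqP -> : maxn (size tcheb_num) (size tcheb_den) == n.+1 by [].
rewrite eqn_leq geq_max sn sd /= leqNgt ltnS geq_max; apply/negP => /andP[].
move=> /leq_sizeP/(_ n (leqnn n)) hn /leq_sizeP/(_ n (leqnn n)) hd.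
have : (b - b') * (- b') ^+ n = 0.
  transitivity (tcheb_den`_n - b' * tcheb_num`_n).
    by rewrite coef_tcheb_num coef_tcheb_den; ring.
  by rewrite hn hd mulr0 subr0.
apply/eqP; rewrite mulf_neq0 //; first by rewrite subr_eq0 eq_sym.
by rewrite expf_neq0 // oppr_eq0 expf_neq0.
Qed.

Lemma rfeval_tcheb x : rfeval (tcheb q b n) x =
  if x is Some a then
    P1frac ((1 - b' * a) ^+ n - (1 - b * a) ^+ n)
           (b * (1 - b' * a) ^+ n - b' * (1 - b * a) ^+ n)
  else P1frac ((- b') ^+ n - (- b) ^+ n) (b * (- b') ^+ n - b' * (- b) ^+ n).
Proof.
rewrite tchebE rfeval_frac ?coprimep_tcheb ?tcheb_den_neq0 //.
case: x => [a|] /=; first by rewrite !hornerE.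
by rewrite max_size_tcheb coef_tcheb_num coef_tcheb_den.
Qed.

End TangentChebyshevFormula.

(** * The Frobenius map on the extension, and the theorem *)

Lemma expf_card_notin_prime (F : finFieldType) (L : fieldExtType F) (x : L) :
  x \notin 1%VS -> x ^+ #|F| != x.
Proof.
apply: contra => /eqP xq.
(* This polynomial splits as the product of the [X - a] with [a] in [F], so its roots in [L] all
   come from [F]. *)
have : root (map_poly (in_alg L) ('X^#|F| - 'X)) x.
  by rewrite rmorphB /= map_polyXn map_polyX rootE !hornerE xq subrr.
rewrite finField_genPoly rmorph_prod rootE horner_prod => /eqP/eqP.
rewrite prodf_seq_eq0 => /hasP[a _ /=].
rewrite rmorphB /= map_polyX map_polyC hornerXsubC subr_eq0 => /eqP ->.
by apply/vlineP; exists a.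
Qed.

(** Raising to the power [#|F|] fixes [-1], and an even power of [-1] is [1]. *)
Lemma even_card_pchar2 (F : finFieldType) : ~~ odd #|F| -> 2%N \in [pchar F].
Proof.
move=> F_even; rewrite inE /= mulr2n -[X in X + _]opprK addrC subr_eq0.
by rewrite -[X in _ == X]expf_card -signr_odd (negPf F_even).
Qed.

(** Frobenius permutes the roots [x] and [x + 1] of [T^2 + T = a], and it moves [x]. *)
Lemma frobenius_artin_schreier (F : finFieldType) (L : fieldExtType F) (x : L) :
    2%N \in [pchar F] -> x \notin 1%VS -> x ^+ 2 + x \in 1%VS ->
  x ^+ #|F| = x + 1.
Proof.
move=> pchar2F xF /vlineP[a xa].
have pchar2 : 2%N \in [pchar L] by rewrite pchar_lalg.
(* [#|F|] is a power of 2, as [F] is an elementary abelian 2-group; hence the power map is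
   additive. *)
have q2 : [pchar L].-nat #|F|.
  have /abelian.abelem_pgroup := abelian.fin_ring_pchar_abelem pchar2F.
  by rewrite /pgroup.pgroup cardsT (eq_pnat _ (pcharf_eq pchar2)).
have : (x ^+ #|F|) ^+ 2 + x ^+ #|F| = x ^+ 2 + x.
  by rewrite exprAC -exprDn_pchar // xa exprZn expr1n expf_card.
move/eqP; rewrite -subr_eq0.
have -> : (x ^+ #|F|) ^+ 2 + x ^+ #|F| - (x ^+ 2 + x) =
  (x ^+ #|F| - x) * (x ^+ #|F| + (x + 1)) by ring.
rewrite mulf_eq0 subr_eq0 (negPf (expf_card_notin_prime xF)) /= addr_eq0.
by rewrite oppr_pchar2 // => /eqP.
Qed.

Theorem proposition4p1 (q : nat) (Fq : finFieldType) (Fq2 : fieldExtType Fq)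
  (zeta beta : Fq2) (n : nat) (k : int)
  (card_Fq : #|Fq| = q) (q_even : ~~ odd q)
  (dim_Fq2 : \dim (fullv : {vspace Fq2}) = 2%N)
  (zeta_neq0 : zeta != 0)
  (beta_notin_Fq : beta \notin 1%VS)
  (alpha_in_Fq : beta ^+ 2 + beta \in 1%VS)
  (n_gt0 : (0 < n)%N) :
  rfeval (tcheb q beta n) (ztan q beta zeta k) = ztan q beta zeta (n%:Z * k).
Proof.
have pchar2F : 2%N \in [pchar Fq] by rewrite even_card_pchar2 ?card_Fq.
have pchar2 : 2%N \in [pchar Fq2] by rewrite pchar_lalg.
have betaq := frobenius_artin_schreier pchar2F beta_notin_Fq alpha_in_Fq.
rewrite card_Fq in betaq.
have betaq_neq : beta ^+ q != beta.
  by rewrite -card_Fq expf_card_notin_prime.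
have beta0 : beta != 0 by apply: contraNneq beta_notin_Fq => ->; rewrite mem0v.
rewrite rfeval_tcheb // /ztan /zsin /zcos /betabar.
have zn (i : int) : zeta ^ (n%:Z * i) = (zeta ^ i) ^+ n.
  by rewrite mulrC -exprz_exp.
rewrite -[- (n%:Z * k)]mulrN !zn; set y := zeta ^ k; set z := zeta ^ - k.
have y0 : y != 0 by rewrite expfz_neq0.
set b' := beta ^+ q in betaq betaq_neq *.
set s := y + z; set c := beta * y + b' * z.
(* Inverts the linear change from [(y, z)] to [(s, c)], using [b' - b = 1]. *)
have yE : y = c - b' * s.
  by rewrite -[LHS](oppr_pchar2 pchar2) /c /s betaq; ring.
have zE : z = c - beta * s by rewrite /c /s betaq; ring.
(* Gives the target the signs of the closed form. *)
have addE (u v : Fq2) : u + v = u - v by rewrite (oppr_pchar2 pchar2).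
rewrite [y ^+ n + _]addE [beta * y ^+ n + _]addE {1}/P1frac.
case: eqP => [c0 | /eqP c0].
  (* The argument is infinity; with [c = 0], [y = - b' s] and [z = - b s], so the coordinates agree
     up to [s^n]. *)
  have s0 : s != 0.
    by apply: contraNneq y0 => s0; rewrite yE c0 s0 mulr0 subr0.
  rewrite -(P1frac_scale _ _ (expf_neq0 n s0)); congr P1frac.
    by rewrite yE zE c0 !sub0r -!mulNr !exprMn; ring.
  by rewrite yE zE c0 !sub0r -!mulNr !exprMn; ring.
(* At the finite point [s / c], homogenize by the factor [c^n]. *)
have scaled w : c * (1 - w * (s / c)) = c - w * s.
  by rewrite mulrBr mulr1 mulrCA [c * _]mulrC divfK.
rewrite yE zE -!scaled !exprMn -(P1frac_scale _ _ (expf_neq0 n c0)).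
by congr P1frac; ring.
Qed.
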